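(* Let $G$ be a countable, torsion-free abelian group and let $\sigma: G \to \mathbb{R}^{2}$ be a group homomorphism such that (1) $\mathbb{Z}^{2} \subseteq \sigma(G)$, and (2) $\sigma(G)$ is dense in $\mathbb{R}^{2}$. Define $$G^{+} = \{0\} \cup \sigma^{-1}\big((0,\infty)\times(0,\infty)\big).$$ Then $(G, G^{+})$ is a simple dimension group. Further, if $u^{1}, u^{2}$ are any elements of $G$ with $\sigma(u^{1}) = (1,0)$ and $\sigma(u^{2}) = (0,1)$, then neither $u^{1}$ nor $u^{2}$ is positive (i.e. neither lies in $G^{+}$), while $u = u^{1}+u^{2}$ is an order unit for $(G,G^{+})$. Let $\sigma_{1}, \sigma_{2}: G \to \mathbb{R}$ be the two coordinate functions of $\sigma$, so $\sigma(g) = (\sigma_{1}(g), \sigma_{2}(g))$ for all $g \in G$. Then $\sigma_{1}, \sigma_{2}$ are states on $(G,G^{+})$ (with respect to $u$), and they are the only extremal states on $(G,G^+)$.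
   Context: An ordered abelian group is a pair $(G,G^{+})$ with $G$ a (countable) abelian group and $G^{+}\subseteq G$ (the positive cone) satisfying $G^{+}+G^{+}\subseteq G^{+}$, $G^{+}-G^{+}=G$, $G^{+}\cap(-G^{+})=\{0\}$; write $a \le b$ if $b-a\in G^{+}$. A positive homomorphism $(G,G^+)\to(H,H^+)$ is a group homomorphism mapping $G^{+}$ into $H^{+}$. $\mathbb{Z}^{I}$ carries the simplicial order $\mathbb{Z}^{I+}=\{n : n(i)\ge 0 \text{ for all } i\}$. A dimension group is an ordered abelian group which is (isomorphic to) the inductive limit, in the category of ordered abelian groups, of a sequence $\mathbb{Z}^{I_1}\to\mathbb{Z}^{I_2}\to\cdots$ of simplicially ordered groups with connecting maps given by non-negative integer matrices; equivalently (Effros–Handelman–Shen), it is countable, unperforated ($ng\in G^{+}$ for some $n\ge1$ implies $g\in G^{+}$) and satisfies Riesz interpolation. An element $u\in G^{+}$ is an order unit if for every $a\in G$ there is a positive integer $k$ with $ku-a\in G^{+}$. A dimension group is simple if it has no order ideals other than $\{0\}$ and $G$; equivalently, every non-zero positive element is an order unit. A state with respect to an order unit $u$ is a positive homomorphism $\tau:(G,G^{+})\to(\mathbb{R},\mathbb{R}^{+})$, where $\mathbb{R}^+=[0,\infty)$, with $\tau(u)=1$. The states form a compact convex subset of $\mathbb{R}^{G}$; a state is extremal if it is an extreme point of this set. *)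

(* Defs.v *)
From HB Require Import structures.
From mathcomp Require Import all_boot all_order all_algebra.
From mathcomp Require Import boolp classical_sets functions cardinality.
From mathcomp Require Import set_interval reals topology normedtype.
Set Implicit Arguments.
Unset Strict Implicit.
Unset Printing Implicit Defensive.
Import Order.TTheory GRing.Theory Num.Theory.
Import numFieldNormedType.Exports.

Local Open Scope classical_set_scope.
Local Open Scope ring_scope.

Definition torsion_free (G : zmodType) :=
  forall (g : G) (n : nat), (0 < n)%N -> g *+ n = 0 -> g = 0.

Definition ordered_group (G : zmodType) (Gp : set G) :=
  [/\ countable [set: G],
      [set a + b | a in Gp & b in Gp] `<=` Gp,
      [set a - b | a in Gp & b in Gp] = [set: G] &
      Gp `&` [set - a | a in Gp] = [set 0]].

Definition positive_hom (G H : zmodType) (Gp : set G) (Hp : set H)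
    (f : G -> H) :=
  zmod_morphism f /\ f @` Gp `<=` Hp.

Definition cocone (X : nat -> zmodType) (Xp : forall k, set (X k))
    (f : forall k, X k -> X k.+1) (G : zmodType) (Gp : set G)
    (mu : forall k, X k -> G) :=
  (forall k, positive_hom (Xp k) Gp (mu k)) /\
  (forall k x, mu k.+1 (f k x) = mu k x).

(* Universal property, in the category of ordered abelian groups and positive
   homomorphisms. *)
Definition inductive_limit (X : nat -> zmodType) (Xp : forall k, set (X k))
    (f : forall k, X k -> X k.+1) (G : zmodType) (Gp : set G)
    (mu : forall k, X k -> G) :=
  [/\ ordered_group Gp, cocone Xp f Gp mu &
      forall (H : zmodType) (Hp : set H) (nu : forall k, X k -> H),
        ordered_group Hp -> cocone Xp f Hp nu ->
        exists! phi : G -> H,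
          positive_hom Gp Hp phi /\ forall k x, phi (mu k x) = nu k x].

Definition simplicial_cone (n : nat) : set 'cV[int]_n :=
  [set x | forall i, 0 <= x i 0].

(* The k-th group Z^(I_k) is the group of integer column vectors indexed by
   'I_(n k), and the connecting maps are multiplication by matrices. *)
Definition dimension_group (G : zmodType) (Gp : set G) :=
  exists (n : nat -> nat) (A : forall k, 'M[int]_(n k.+1, n k)),
    (forall k i j, 0 <= A k i j) /\
    exists mu : forall k, 'cV[int]_(n k) -> G,
      inductive_limit (X := fun k => 'cV[int]_(n k))
        (fun k => @simplicial_cone (n k)) (fun k x => A k *m x) Gp mu.

Definition order_ideal (G : zmodType) (Gp J : set G) :=
  [/\ J 0 /\ (forall a b, J a -> J b -> J (a - b)),
      J `<=` [set a - b | a in J `&` Gp & b in J `&` Gp] &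
      forall a b, Gp a -> Gp (b - a) -> J b -> J a].

Definition simple_dimension_group (G : zmodType) (Gp : set G) :=
  dimension_group Gp /\
  forall J, order_ideal Gp J -> J = [set 0] \/ J = [set: G].

Definition order_unit (G : zmodType) (Gp : set G) (u : G) :=
  Gp u /\ forall a, exists k : nat, (0 < k)%N /\ Gp (u *+ k - a).

Definition states (R : realType) (G : zmodType) (Gp : set G) (u : G) :
    set (G -> R^o) :=
  [set tau | positive_hom Gp [set x : R | 0 <= x] tau /\ tau u = 1].

Arguments states R {G}.

Definition extreme_points (R : realType) (V : lmodType R) (S : set V) :
    set V :=
  [set x | S x /\ forall (y z : V) (t : R), S y -> S z -> 0 < t < 1 ->
             x = t *: y + (1 - t) *: z -> y = x /\ z = x].

Definition extremal_states (R : realType) (G : zmodType) (Gp : set G) (u : G) :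
    set (G -> R^o) :=
  extreme_points (states R Gp u).
Arguments extremal_states R {G}.

(* Main.v *)
(** The cone is unperforated because G is torsion-free, and it has the Riesz
decomposition property because the image of sigma is dense: except in
degenerate cases, splitting a <= b1 + b2 amounts to finding a point of the image
in a nonempty open rectangle.  A countable unperforated ordered group with Riesz
decomposition is a dimension group (Effros-Handelman-Shen): given positive
elements g, Shen's argument rewrites them as non-negative integer combinations
of positive elements h in such a way that a given integral relation among the g
becomes trivial; a choice of h minimizing the rank of the transition matrix
then trivializes all the relations at once, and iterating this while adjoining
the positive elements of G one by one gives the inductive system.

A state tau is determined by its values at u1 and u2, because n g can be
compared with integer combinations of u1 and u2 up to a bounded error; hence tau
is the barycenter of sigma1 and sigma2 with weights tau(u1) and tau(u2). *)
Require Import Defs.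
From HB Require Import structures.
From mathcomp Require Import all_boot all_order all_algebra.
From mathcomp Require Import boolp classical_sets functions cardinality.
From mathcomp Require Import set_interval reals topology normedtype.
From mathcomp Require Import zify lra.
Set Implicit Arguments.
Unset Strict Implicit.
Unset Printing Implicit Defensive.
Import Order.TTheory GRing.Theory Num.Theory.
Import numFieldNormedType.Exports.
Local Open Scope classical_set_scope.
Local Open Scope ring_scope.

(** * Integer relations among positive elements of an ordered group *)

Definition unperforated (G : zmodType) (Gp : set G) :=
  forall (g : G) (n : nat), (0 < n)%N -> Gp (g *+ n) -> Gp g.

Definition riesz_decomposition (G : zmodType) (Gp : set G) :=
  forall a b1 b2 : G, Gp a -> Gp b1 -> Gp b2 -> Gp (b1 + b2 - a) ->
  exists c, [/\ Gp c, Gp (b1 - c), Gp (a - c) & Gp (b2 - (a - c))].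

Definition comb (G : zmodType) (I : finType) (h : I -> G) (x : I -> int) : G :=
  \sum_i h i *~ x i.

(** This is multiplication of the vector [x] by the matrix [B]. Arbitrary finite index types let
    split generators be indexed by a sum type. *)
Definition push (I J : finType) (B : J -> I -> nat) (x : I -> int) (j : J) :
    int :=
  \sum_i x i *+ B j i.

Definition refines (G : zmodType) (Gp : set G) (I J : finType)
    (g : I -> G) (h : J -> G) (B : J -> I -> nat) :=
  (forall j, Gp (h j)) /\ (forall i, g i = \sum_j h j *+ B j i).

Section Cone.
Context (G : zmodType) (Gp : set G) (ordGp : ordered_group Gp).

Lemma cone0 : Gp 0.
Proof. by case: ordGp => _ _ _ /seteqP[_ /(_ 0 erefl)[]]. Qed.

Lemma coneD a b : Gp a -> Gp b -> Gp (a + b).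
Proof.
by case: ordGp => _ H _ _ pa pb; apply: H; exists a => //; exists b.
Qed.

Lemma cone_anti a : Gp a -> Gp (- a) -> a = 0.
Proof.
case: ordGp => _ _ _ /seteqP[H _] pa pNa; apply: (H a); split => //.
by exists (- a) => //; rewrite opprK.
Qed.

Lemma coneMn a n : Gp a -> Gp (a *+ n).
Proof.
move=> pa; elim: n => [|n IH]; first by rewrite mulr0n; exact: cone0.
by rewrite mulrS; exact: coneD.
Qed.

Lemma coneMz a (z : int) : Gp a -> 0 <= z -> Gp (a *~ z).
Proof. by move=> pa; case: z => // n _; exact: coneMn. Qed.

Lemma cone_sum (I : Type) (r : seq I) (P : pred I) (F : I -> G) :
  (forall i, P i -> Gp (F i)) -> Gp (\sum_(i <- r | P i) F i).
Proof. by move=> pF; apply: big_ind => //; [exact: cone0|exact: coneD]. Qed.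

Lemma coneB a : exists b c, [/\ Gp b, Gp c & a = b - c].
Proof.
case: ordGp => _ _ /seteqP[_ /(_ a I)[b pb [c pc <-]]] _.
by exists b, c.
Qed.

(** Induction on [s]: binary decomposition splits [a] between the head [b i] and the sum over the
    tail. For empty [s], both [a] and [- a] are positive, so [a = 0]. Uniqueness of the entries lets
    the value at [i] be overridden without disturbing the tail. *)
Lemma riesz_sum (I : eqType) (s : seq I) (b : I -> G) (a : G) :
  riesz_decomposition Gp -> uniq s -> (forall i, Gp (b i)) ->
  Gp a -> Gp (\sum_(i <- s) b i - a) ->
  exists c : I -> G,
    (forall i, Gp (c i) /\ Gp (b i - c i)) /\ \sum_(i <- s) c i = a.
Proof.
move=> rGp + pb; elim: s a => [|i s IH] a /=.
  move=> _ pa; rewrite big_nil sub0r => pNa; exists (fun=> 0).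
  split; last by rewrite big_nil (cone_anti pa).
  by move=> i; rewrite subr0; split; [exact: cone0|exact: pb].
move=> /andP[iNs us] pa; rewrite big_cons => pba.
have [|c1 [pc1 pbc1 pac pbac]] := rGp _ _ _ pa (pb i) _ pba.
  exact: cone_sum.
have [c [pc sc]] := IH _ us pac pbac.
exists (fun j => if j == i then c1 else c j); split.
  by move=> j; case: eqP => // ->.
rewrite big_cons eqxx (eq_big_seq c) ?sc ?subrKC // => j js.
by case: eqP => // ji; rewrite -ji js in iNs.
Qed.

(** Relations among the [g] thus become relations among the [h], so that refinement can be
    repeated. *)
Lemma comb_push (I J : finType) (g : I -> G) (h : J -> G) B x :
  refines Gp g h B -> comb h (push B x) = comb g x.
Proof.
move=> [_ gE]; rewrite /comb /push.
under eq_bigr do rewrite mulrz_sumr.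
rewrite exchange_big; apply: eq_bigr => i _.
rewrite gE mulrz_suml; apply: eq_bigr => j _.
by rewrite -mulr_natl natz mulrzA -pmulrn.
Qed.

(* With [a i1 = m.+1] the largest coefficient in absolute value, unperforation
   gives [g i1 <= \sum_(a i < 0) g i]; split [g i1] accordingly as
   [\sum_(a i < 0) c i].  The pieces [c i] get the coefficients
   [m.+1 + a i] and [g i1] disappears. *)
Lemma split_max (I : finType) (g : I -> G) (a : I -> int) (m : nat) (i1 : I) :
  unperforated Gp -> riesz_decomposition Gp ->
  (forall i, Gp (g i)) -> comb g a = 0 -> (forall i, (`|a i| <= m.+1)%N) ->
  a i1 = m.+1 ->
  exists (J : finType) (h : J -> G) (B : J -> I -> nat),
    [/\ refines Gp g h B, forall j, (`|push B a j| <= m.+1)%N &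
        (#|[pred j | `|push B a j|%N == m.+1]| <
          #|[pred i | `|a i|%N == m.+1]|)%N].
Proof.
move=> uGp rGp pg g0 am a1.
pose b i := if a i < 0 then g i else 0.
have pb i : Gp (b i) by rewrite /b; case: ifP => // _; exact: cone0.
(* Multiply by [m.+1] and add the zero element [comb g a]: the terms in [g i1] cancel, and the
   others have coefficient [m.+1 + a i] if [a i < 0] and [a i] otherwise, all non-negative. *)
have pbg : Gp (\sum_i b i - g i1).
  apply: (uGp _ m.+1) => //.
  rewrite mulrnBl -sumrMnl -[X in X - _]addr0 -[X in _ + X - _]g0.
  rewrite /comb -big_split /=.
  rewrite (bigD1 i1) //= {1}/b a1 /= mul0rn add0r.
  rewrite addrAC subrr add0r; apply: cone_sum => i _; rewrite /b.
  have := am i; case: ifPn => ai.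
    rewrite pmulrn -mulrzDr => ?; apply: coneMz => //; lia.
  by rewrite mul0rn add0r => _; apply: coneMz => //; lia.
have [c [pc cg]] := riesz_sum rGp (index_enum_uniq I) pb (pg i1) pbg.
have c0 i : (a i < 0) = false -> c i = 0.
  move=> ai; have [pci] := pc i; rewrite /b ai sub0r; exact: cone_anti.
have pick1 (V : zmodType) (F : I -> V) k : \sum_i F i *+ (i == k) = F k.
  by rewrite (bigD1 k) //= eqxx big1 ?addr0 // => i /negPf ->.
(* [inl i] carries what remains of [g i] after [c i] is removed, and 0 at [i1]; [inr i] carries
   [c i], which is a piece of both [g i] and [g i1]. *)
pose h (j : I + I) := match j with
  | inl i => if i == i1 then 0 else g i - c i
  | inr i => c i end.
pose B (j : I + I) (i : I) : nat := match j with
  | inl k => (i == k) && (k != i1)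
  | inr k => (a k < 0) && ((i == k) || (i == i1)) end.
have Bl k : push B a (inl k) = if k == i1 then 0 else a k.
  rewrite /push /B; case: eqP => [_|_]; last first.
    by under eq_bigr do rewrite andbT; rewrite pick1.
  by under eq_bigr do rewrite andbF mulr0n; rewrite big1.
have Br k : push B a (inr k) = if a k < 0 then a k + a i1 else 0.
  rewrite /push /B; case: ifP => ak /=; last by rewrite big1.
  have ki1 : k != i1 by apply/eqP => ki; rewrite ki a1 in ak.
  rewrite (bigD1 k) //= eqxx mulr1n (bigD1 i1) /=; last by rewrite eq_sym.
  rewrite eqxx orbT mulr1n big1 ?addr0 // => i /andP[/negPf -> /negPf ->].
  by rewrite mulr0n.
exists (I + I)%type, h, B; split.
- split=> [[i|i]|i] /=; last 1 first.
  + rewrite big_sumType /=.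
    have [->|ii1] := eqVneq i i1.
      rewrite big1 ?add0r; last first.
        by move=> k _; rewrite eq_sym; case: eqVneq.
      rewrite -cg; apply: eq_bigr => k _; rewrite orbT andbT.
      by case: (boolP (a k < 0)) => // /negPf ak; rewrite c0 // mul0rn.
    rewrite -(subrK (c i) (g i)); congr (_ + _).
      rewrite (bigD1 i) //= (negPf ii1) eqxx /= big1 ?addr0 // => k ki.
      by rewrite [i == k]eq_sym (negPf ki).
    rewrite -[LHS](pick1 _ c); apply: eq_bigr => k _.
    rewrite orbF [i == k]eq_sym.
    by case: (boolP (a k < 0)) => // /negPf ak; rewrite (c0 _ ak) !mul0rn.
  + case: ifP => _; first exact: cone0.
    case: (boolP (a i < 0)) => ai; first by have [_] := pc i; rewrite /b ai.
    by rewrite c0 ?subr0 //; exact: negPf.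
  + by have [] := pc i.
- move=> [i|i]; rewrite ?Bl ?Br; case: ifP => //.
  by have := am i; rewrite a1; lia.
(* The coefficients at [inr k] lie between 0 and [m], so absolute value [m.+1] occurs only at
   [inl k] with [k != i1], where [a k] had it already. *)
have /leq_ltn_trans : (#|[pred j | `|push B a j|%N == m.+1]| <=
    #|[seq (inl i : I + I) |
        i in [predD1 [pred i | `|a i|%N == m.+1] & i1]]|)%N.
  apply: subset_leq_card; apply/fintype.subsetP => -[k|k];
    rewrite inE /= ?Bl ?Br.
    by case: ifPn => // ki1 ak; apply: fintype.image_f; rewrite !inE ki1.
  by case: ifP => //; have := am k; rewrite a1; lia.
apply; rewrite fintype.card_image; last by move=> x y [].
by rewrite [X in (_ < X)%N](cardD1 i1) inE a1 eqxx.
Qed.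

Lemma push_comp (I J K : finType) (B : J -> I -> nat) (C : K -> J -> nat) x :
  push C (push B x) =1 push (fun k i => \sum_j C k j * B j i)%N x.
Proof.
move=> k; rewrite /push.
under eq_bigr do rewrite -sumrMnl.
rewrite exchange_big; apply: eq_bigr => i _.
by rewrite -sumrMnr; apply: eq_bigr => j _; rewrite -mulrnA mulnC.
Qed.

Lemma refines_comp (I J K : finType) (g : I -> G) (h : J -> G) (l : K -> G)
    B C :
  refines Gp g h B -> refines Gp h l C ->
  refines Gp g l (fun k i => \sum_j C k j * B j i)%N.
Proof.
move=> [ph gE] [pl hE]; split=> // i; rewrite gE.
under eq_bigr do rewrite hE -sumrMnl.
rewrite exchange_big; apply: eq_bigr => k _.
by rewrite -sumrMnr; apply: eq_bigr => j _; rewrite -mulrnA.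
Qed.

(** Double induction: on a bound for the absolute values of the coefficients, then on the number of
    coefficients attaining it. Each use of [split_max] lowers that number; once it is 0, the bound
    itself drops. At bound 0 the identity matrix serves. *)
Lemma kill_relation (I : finType) (g : I -> G) (a : I -> int) :
  unperforated Gp -> riesz_decomposition Gp ->
  (forall i, Gp (g i)) -> comb g a = 0 ->
  exists (J : finType) (h : J -> G) (B : J -> I -> nat),
    refines Gp g h B /\ forall j, push B a j = 0.
Proof.
move=> uGp rGp pg g0.
have [m am] : exists m, forall i, (`|a i| <= m)%N.
  by exists (\max_i `|a i|)%N => i; exact: leq_bigmax.
elim: m I g a pg g0 am => [|m IHm] I g a pg g0 am.
  exists I, g, (fun j i => (i == j) : nat); split.
    split=> // i; rewrite (bigD1 i) //= eqxx big1 ?addr0 // => k ki.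
    by rewrite eq_sym (negPf ki).
  move=> j; rewrite /push big1 // => i _.
  by have := am i; rewrite leqn0 absz_eq0 => /eqP ->; rewrite mul0rn.
have [c] := ubnP #|[pred i | `|a i|%N == m.+1]|.
elim: c I g a pg g0 am => // c IHc I g a pg g0 am; rewrite ltnS => ac.
have [i1 /eqP a1|am'] := pickP [pred i | `|a i|%N == m.+1]; last first.
  apply: IHm => // i; have := am i; rewrite leq_eqVlt ltnS.
  by have /= -> := am' i.
rewrite /= in a1.
have [J [h [B [gh hm hc]]]] :
    exists (J : finType) (h : J -> G) (B : J -> I -> nat),
    [/\ refines Gp g h B, forall j, (`|push B a j| <= m.+1)%N &
      (#|[pred j | `|push B a j|%N == m.+1]| <
        #|[pred i | `|a i|%N == m.+1]|)%N].
  case: (leP 0 (a i1)) => a10.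
    by apply: (split_max (i1 := i1)) => //; lia.
  (* If the chosen coefficient is negative, [split_max] is applied to the opposite relation; [push]
     only changes sign. *)
  have NB (J : finType) (B : J -> I -> nat) j :
      push B (fun i => - a i) j = - push B a j.
    by rewrite /push -sumrN; apply: eq_bigr => i _; rewrite mulNrn.
  have [|||J [h [B [gh hm hc]]]] :=
    @split_max I g (fun i => - a i) m i1 uGp rGp pg.
  - rewrite /comb; under eq_bigr do rewrite mulrNz.
    by rewrite sumrN -/(comb g a) g0 oppr0.
  - by move=> i; rewrite abszN.
  - lia.
  exists J, h, B; split=> //; first by move=> j; rewrite -abszN -NB.
  move: hc; rewrite (eq_card (B := [pred i | `|a i|%N == m.+1])); last first.
    by move=> i; rewrite !inE abszN.
  by congr (_ < _)%N; apply: eq_card => j; rewrite !inE NB abszN.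
have [||||K [l [C [hl l0]]]] := IHc _ h (push B a);
  rewrite ?(comb_push _ gh) //.
- by case: gh.
- exact: leq_trans hc ac.
exists K, l, (fun k i => \sum_j C k j * B j i)%N; split.
  exact: refines_comp gh hl.
by move=> k; rewrite -push_comp.
Qed.
End Cone.

(** * Matrix form of refinements, and the rank that decreases *)

(** If the ranks over the rationals agreed, [A] and [B *m A] would have the same row space, so
    [A = D *m (B *m A)] for some rational [D], and [B *m (A *m x) = 0] would force [A *m x = 0]. *)
Lemma mxrank_kill (m n k : nat) (A : 'M[int]_(m, n)) (B : 'M[int]_(k, m))
    (x : 'cV[int]_n) :
  A *m x != 0 -> B *m (A *m x) = 0 ->
  (\rank (map_mx (intr : int -> rat) (B *m A)) <
   \rank (map_mx (intr : int -> rat) A))%N.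
Proof.
move=> Ax0 BAx0; rewrite map_mxM ltn_neqAle mxrankM_maxr andbT.
apply: contra Ax0; rewrite (mxrank_leqif_eq (submxMl _ _)) => /andP[_].
move=> /submxP[D AE].
have /eqP : map_mx (intr : int -> rat) (A *m x) = 0.
  by rewrite map_mxM AE -mulmxA -!map_mxM -mulmxA BAx0 map_mx0 mulmx0.
rewrite -[0](map_mx0 (intr : {rmorphism int -> rat})) => /eqP /matrixP e.
apply/eqP/matrixP => i j.
by have := e i j; rewrite !mxE => /intr_inj.
Qed.

Definition vcomb (G : zmodType) (n : nat) (g : 'I_n -> G)
    (x : 'cV[int]_n) : G :=
  \sum_i g i *~ x i 0.

(** The counterpart of [refines] for integer matrices acting on column vectors, the format of the
    connecting maps in [dimension_group]. *)
Definition mx_refines (G : zmodType) (Gp : set G) (m n : nat)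
    (g : 'I_n -> G) (h : 'I_m -> G) (A : 'M[int]_(m, n)) :=
  [/\ forall j, Gp (h j), forall i j, 0 <= A i j &
      forall i, g i = \sum_j h j *~ A j i].

Lemma vcomb_mx (G : zmodType) (Gp : set G) (m n : nat)
    (g : 'I_n -> G) (h : 'I_m -> G) (A : 'M[int]_(m, n)) x :
  mx_refines Gp g h A -> vcomb h (A *m x) = vcomb g x.
Proof.
move=> [_ _ gE]; rewrite /vcomb.
under eq_bigr do rewrite mxE mulrz_sumr.
rewrite exchange_big; apply: eq_bigr => i _.
rewrite gE mulrz_suml; apply: eq_bigr => j _.
by rewrite mulrzA.
Qed.

Lemma vcombB (G : zmodType) (n : nat) (g : 'I_n -> G) : zmod_morphism (vcomb g).
Proof.
move=> x y; rewrite /vcomb -sumrB; apply: eq_bigr => i _.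
by rewrite !mxE mulrzBr.
Qed.

Lemma mx_refines_comp (G : zmodType) (Gp : set G) (m n k : nat)
    (g : 'I_n -> G) (h : 'I_m -> G) (l : 'I_k -> G) A B :
  mx_refines Gp g h A -> mx_refines Gp h l B -> mx_refines Gp g l (B *m A).
Proof.
move=> [ph A0 gE] [pl B0 hE]; split=> // [i j|i].
  by rewrite mxE sumr_ge0 // => q _; rewrite mulr_ge0.
rewrite gE; under eq_bigr do rewrite hE mulrz_suml.
rewrite exchange_big; apply: eq_bigr => q _.
by rewrite mxE mulrz_sumr; apply: eq_bigr => j _; rewrite mulrzA.
Qed.

(** * Shen's argument and the construction of the inductive system *)

Section Shen.
Context (G : zmodType) (Gp : set G) (ordGp : ordered_group Gp).
Context (uGp : unperforated Gp) (rGp : riesz_decomposition Gp).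

Lemma vcomb_ge0 (n : nat) (g : 'I_n -> G) x :
  (forall i, Gp (g i)) -> simplicial_cone x -> Gp (vcomb g x).
Proof.
by move=> pg x0; apply: cone_sum => // i _; apply: coneMz => //; exact: x0.
Qed.

Lemma kill_relation_mx (n : nat) (g : 'I_n -> G) (x : 'cV[int]_n) :
  (forall i, Gp (g i)) -> vcomb g x = 0 ->
  exists (m : nat) (h : 'I_m -> G) (A : 'M[int]_(m, n)),
    mx_refines Gp g h A /\ A *m x = 0.
Proof.
move=> pg gx0.
have [J [h [B [[ph gE] Bx]]]] :=
  kill_relation (a := fun i => x i 0) ordGp uGp rGp pg gx0.
exists #|J|, (fun j => h (enum_val j)).
exists (\matrix_(j, i) (B (enum_val j) i)%:Z); split.
  split=> // [i j|i]; first by rewrite mxE.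
  rewrite gE (reindex _ (onW_bij _ (@enum_val_bij J))) /=.
  by apply: eq_bigr => j _; rewrite mxE.
apply/matrixP => j k; rewrite ord1 !mxE; apply: etrans (Bx (enum_val j)).
by rewrite /push; apply: eq_bigr => i _; rewrite mxE -mulr_natl natz.
Qed.

(** Induction on the rational rank of a refinement matrix [A], starting from the identity. If a
    relation [x] of [g] has [A *m x != 0], then [A *m x] is a relation of [h]; killing it by some
    [B] gives the refinement [B *m A] of smaller rank. *)
Lemma kill_kernel (n : nat) (g : 'I_n -> G) :
  (forall i, Gp (g i)) ->
  exists (m : nat) (h : 'I_m -> G) (A : 'M[int]_(m, n)),
    mx_refines Gp g h A /\ forall x, vcomb g x = 0 -> A *m x = 0.
Proof.
move=> pg.
have : exists (m : nat) (h : 'I_m -> G) (A : 'M[int]_(m, n)),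
    mx_refines Gp g h A.
  exists n, g, 1%:M; split=> // [i j|i]; first by rewrite mxE; case: eqP.
  rewrite (bigD1 i) //= mxE eqxx mulr1z big1 ?addr0 // => j ji.
  by rewrite mxE (negPf ji) mulr0z.
move=> [m [h [A]]].
have [r] := ubnP (\rank (map_mx (intr : int -> rat) A)).
elim: r m h A => // r IH m h A; rewrite ltnS => rA gh.
have [kA|/existsNP[x /not_implyP[gx0 /eqP Ax0]]] :=
    pselect (forall x, vcomb g x = 0 -> A *m x = 0); first by exists m, h, A.
have [ph _ _] := gh.
have [|k [l [B [hl Bx]]]] := @kill_relation_mx _ h (A *m x) ph.
  by rewrite (vcomb_mx _ gh).
apply: (IH _ l (B *m A)); last exact: mx_refines_comp gh hl.
exact: leq_trans (mxrank_kill Ax0 Bx) rA.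
Qed.

Lemma refine_step (n : nat) (g : 'I_n -> G) (p : G) :
  (forall i, Gp (g i)) -> Gp p ->
  exists (m : nat) (h : 'I_m -> G) (A : 'M[int]_(m, n)),
    [/\ mx_refines Gp g h A, forall x, vcomb g x = 0 -> A *m x = 0 &
        exists2 x, simplicial_cone x & vcomb h x = p].
Proof.
move=> pg pp.
(* The element [p] is adjoined at index [ord0], and [A0] includes the old generators. After the
   kernel is killed, [p] is represented by the first column of [A], which is non-negative. *)
pose g' i := if unlift ord0 i is Some j then g j else p.
pose A0 : 'M[int]_(n.+1, n) := \matrix_(i, j) (i == lift ord0 j)%:R.
have pg' i : Gp (g' i) by rewrite /g'; case: unlift.
have gg' : mx_refines Gp g g' A0.
  split=> // [i j|i]; first by rewrite mxE ler0n.
  rewrite (bigD1 (lift ord0 i)) //= mxE eqxx mulr1z /g' liftK.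
  by rewrite big1 ?addr0 // => j ji; rewrite mxE (negPf ji) mulr0z.
have [m [h [A [g'h kA]]]] := kill_kernel pg'.
exists m, h, (A *m A0); split.
- exact: mx_refines_comp gg' g'h.
- by move=> x gx; rewrite -mulmxA kA // (vcomb_mx _ gg').
- have [_ A_ge0 _] := g'h.
  exists (A *m delta_mx ord0 0).
    by move=> i; rewrite -colE mxE.
  rewrite (vcomb_mx _ g'h) /vcomb (bigD1 ord0) //= mxE !eqxx mulr1z.
  rewrite /g' unlift_none big1 ?addr0 // => j j0.
  by rewrite mxE (negPf j0) mulr0z.
Qed.

(** Every element of [G] is a difference of positive ones, hence comes from some stage. The factor
    map [phi] must send [mu k x] to [nu k x]; the condition on kernels makes this well defined, and
    surjectivity onto the cone makes [phi] positive. *)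
Lemma inductive_limitP (X : nat -> zmodType) (Xp : forall k, set (X k))
    (f : forall k, X k -> X k.+1) (mu : forall k, X k -> G) :
  cocone Xp f Gp mu ->
  (forall k x, mu k x = 0 -> f k x = 0) ->
  (forall p, Gp p -> exists k, exists2 x, Xp k x & mu k x = p) ->
  inductive_limit Xp f Gp mu.
Proof.
move=> cmu kf smu; split=> // H Hp nu _ [nup nuf].
have [mup muf] := cmu.
have muB k x y : mu k (x - y) = mu k x - mu k y by have [] := mup k.
have nuB k x y : nu k (x - y) = nu k x - nu k y by have [] := nup k.
have nu0 k : nu k 0 = 0 by rewrite -(subrr (0 : X k)) nuB subrr.
have lift k l x : (k <= l)%N -> exists2 y, mu l y = mu k x & nu l y = nu k x.
  elim: l => [|l IH]; first by rewrite leqn0 => /eqP kl; subst k; exists x.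
  rewrite leq_eqVlt => /predU1P[kl|/IH [y yE1 yE2]]; first by subst k; exists x.
  by exists (f l y); rewrite ?muf ?nuf.
(* Lifted to a common stage, the two representatives differ by an element of the kernel of [mu],
   which the next connecting map sends to 0. *)
have numu k l x y : mu k x = mu l y -> nu k x = nu l y.
  move=> e; have [x' x1 <-] := lift k (maxn k l) x (leq_maxl _ _).
  have [y' y1 <-] := lift l (maxn k l) y (leq_maxr _ _).
  by apply/subr0_eq; rewrite -nuB -nuf kf ?nu0 // muB x1 y1 e subrr.
have common a b : exists k x y,
    mu k x = a /\ mu k y = b /\ mu k (x - y) = a - b.
  have ex c : exists k x, mu k x = c.
    have [p [q [/smu[k [x _ <-]] /smu[l [y _ <-]] ->]]] := coneB ordGp c.
    have [x' <- _] := lift k (maxn k l) x (leq_maxl _ _).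
    have [y' <- _] := lift l (maxn k l) y (leq_maxr _ _).
    by exists (maxn k l), (x' - y').
  have [k [x xa]] := ex a; have [l [y yb]] := ex b.
  have [x' x1 _] := lift k (maxn k l) x (leq_maxl _ _).
  have [y' y1 _] := lift l (maxn k l) y (leq_maxr _ _).
  by exists (maxn k l), x', y'; rewrite muB x1 y1 xa yb.
have exphi c : exists d, forall k x, mu k x = c -> nu k x = d.
  have [k [x [_ [<- _]]]] := common c c.
  by exists (nu k x) => l y; exact: numu.
pose phi c := projT1 (cid (exphi c)).
have phiE k x : phi (mu k x) = nu k x.
  by rewrite /phi; case: cid => d /= /(_ k x erefl).
exists phi; split.
  split=> //; split.
    move=> a b; have [k [x [y [<- [<- <-]]]]] := common a b.
    by rewrite !phiE nuB.
  move=> _ [p /smu[k [x xp <-]] <-]; rewrite phiE.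
  by have [_] := nup k; apply; exists x.
move=> psi [_ psiE]; apply/funext => a.
by have [k [x [_ [<- _]]]] := common a a; rewrite phiE psiE.
Qed.

(** The stages are finite families of positive elements, beginning with the empty one. With [f] an
    injection of [G] into the naturals, step [k] kills all relations of the current family and
    adjoins the positive element of code [k], if there is one. Hence a positive [p] is represented
    at stage [(f p).+1]. *)
Lemma dimension_groupP : dimension_group Gp.
Proof.
have [/countable_injP[f finj] _ _ _] := ordGp.
pose state := {s : {n : nat & 'I_n -> G} | forall i, Gp (projT2 s i)}.
pose dim (s : state) := projT1 (sval s).
pose gen (s : state) : 'I_(dim s) -> G := projT2 (sval s).
pose good k (s t : state) (A : 'M[int]_(dim t, dim s)) :=
  [/\ mx_refines Gp (gen s) (gen t) A,
      forall x, vcomb (gen s) x = 0 -> A *m x = 0 &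
      forall p, Gp p -> f p = k ->
        exists2 x, simplicial_cone x & vcomb (gen t) x = p].
have next k s : exists u : {t : state & 'M[int]_(dim t, dim s)},
    good k s (projT1 u) (projT2 u).
  have [[p [pp pk]]|Np] := pselect (exists p, Gp p /\ f p = k).
    have [m [h [A [gh kA xA]]]] := refine_step (svalP s) pp.
    have [ph _ _] := gh.
    exists (existT (fun t : state => 'M[int]_(dim t, dim s))
              (exist _ (existT (fun n => 'I_n -> G) m h) ph) A).
    by split=> // q _ qk; rewrite (finj q p) ?inE ?pk.
  have [m [h [A [gh kA]]]] := kill_kernel (svalP s).
  have [ph _ _] := gh.
  exists (existT (fun t : state => 'M[int]_(dim t, dim s))
            (exist _ (existT (fun n => 'I_n -> G) m h) ph) A).
  by split=> // p pp pk; case: Np; exists p.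
have s0P : forall i, Gp (projT2 (existT (fun n => 'I_n -> G) 0%N (fun=> 0)) i).
  by move=> i; exact: cone0.
pose st := fix st k : state := if k is k'.+1
  then projT1 (projT1 (cid (next k' (st k')))) else exist _ _ s0P.
pose A k : 'M[int]_(dim (st k.+1), dim (st k)) :=
  projT2 (projT1 (cid (next k (st k)))).
have AP k : good k (st k) (st k.+1) (A k).
  exact (projT2 (cid (next k (st k)))).
exists (fun k => dim (st k)), A; split.
  by move=> k; have [[]] := AP k.
exists (fun k => vcomb (gen (st k))); apply: inductive_limitP.
- split=> k; last by move=> x; have [gh _ _] := AP k; exact: vcomb_mx gh.
  split; first exact: vcombB.
  by move=> _ [x x0 <-]; apply: vcomb_ge0 => //; exact: svalP (st k).
- by move=> k x; have [_ + _] := AP k; apply.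
- move=> p pp; have [_ _ /(_ p pp erefl)[x x0 xp]] := AP (f p).
  by exists (f p).+1, x.
Qed.

End Shen.

(** * The cone of elements strictly positive in both coordinates *)

Definition strict_cone (R : realType) (G : zmodType)
    (sigma : {additive G -> (R * R)%type}) : set G :=
  [set 0] `|` sigma @^-1` (`]0, +oo[ `*` `]0, +oo[).

Section StrictCone.
Context (R : realType) (G : zmodType) (sigma : {additive G -> (R * R)%type}).
Context (Gcountable : countable [set: G]) (Gtf : torsion_free G).
Context (sigmaZ2 : [set (a%:~R, b%:~R) | a in [set: int] & b in [set: int]]
               `<=` range sigma).
Context (sigma_dense : dense (range sigma)).

Let Gp := strict_cone sigma.
Let s1 g := (sigma g).1.
Let s2 g := (sigma g).2.

Lemma strict_coneP g : Gp g <-> g = 0 \/ (0 < s1 g /\ 0 < s2 g).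
Proof.
rewrite /Gp /strict_cone /setU /= /setX /= !in_itv /= !andbT.
by split; (case=> [|[? ?]]; [left|right]).
Qed.

Lemma strict_cone_gt0 g : 0 < s1 g -> 0 < s2 g -> Gp g.
Proof. by move=> *; apply/strict_coneP; right. Qed.

Lemma fst_sigmaD a b : s1 (a + b) = s1 a + s1 b.
Proof. by rewrite /s1 raddfD. Qed.
Lemma snd_sigmaD a b : s2 (a + b) = s2 a + s2 b.
Proof. by rewrite /s2 raddfD. Qed.
Lemma fst_sigmaN a : s1 (- a) = - s1 a.
Proof. by rewrite /s1 raddfN. Qed.
Lemma snd_sigmaN a : s2 (- a) = - s2 a.
Proof. by rewrite /s2 raddfN. Qed.
Lemma fst_sigmaMn a n : s1 (a *+ n) = s1 a *+ n.
Proof. by rewrite /s1 !raddfMn. Qed.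
Lemma snd_sigmaMn a n : s2 (a *+ n) = s2 a *+ n.
Proof. by rewrite /s2 !raddfMn. Qed.
Lemma fst_sigma0 : s1 0 = 0. Proof. by rewrite /s1 raddf0. Qed.
Lemma snd_sigma0 : s2 0 = 0. Proof. by rewrite /s2 raddf0. Qed.
Let sE := (fst_sigmaD, snd_sigmaD, fst_sigmaN, snd_sigmaN, fst_sigmaMn,
  snd_sigmaMn, fst_sigma0, snd_sigma0).

(** Density in the form used for Riesz decomposition: an open rectangle is open and contains its
    centre. *)
Lemma sigma_box (x1 y1 x2 y2 : R) : x1 < y1 -> x2 < y2 ->
  exists g, [/\ x1 < s1 g, s1 g < y1, x2 < s2 g & s2 g < y2].
Proof.
move=> xy1 xy2.
have [] := sigma_dense (O := `]x1, y1[%classic `*` `]x2, y2[%classic).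
- exists ((x1 + y1) / 2, (x2 + y2) / 2).
  by rewrite /setX /= !in_itv /=; split; lra.
- apply: (openI (A := fst @^-1` `]x1, y1[%classic)
                (B := snd @^-1` `]x2, y2[%classic)).
  + by apply: open_comp => [x _|]; [exact: cvg_fst|exact: itv_open].
  + by apply: open_comp => [x _|]; [exact: cvg_snd|exact: itv_open].
- move=> x [+ [g _ gx]]; rewrite -{x}gx /setX /= !in_itv /=.
  move=> -[/andP[? ?] /andP[? ?]].
  by exists g.
Qed.

Lemma sigma_unbounded (x : R) : exists g, x < s1 g /\ x < s2 g.
Proof.
have [|g _ gE] := @sigmaZ2 ((Num.trunc x).+1%:R, (Num.trunc x).+1%:R).
  by exists (Num.trunc x).+1 => //; exists (Num.trunc x).+1.
by exists g; rewrite /s1 /s2 gE /= truncnS_gt.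
Qed.

Lemma ordered_strict_cone : ordered_group Gp.
Proof.
split=> //.
- move=> _ [a /strict_coneP pa [b /strict_coneP pb <-]]; apply/strict_coneP.
  case: pa => [->|[a1 a2]]; first by rewrite add0r.
  case: pb => [->|[b1 b2]]; first by rewrite addr0; right.
  by right; rewrite !sE; split; lra.
- apply/seteqP; split=> // g _.
  (* Both coordinates of [v] dominate those of [g] in absolute value, so [g = (g + v) - v] is a
     difference of positive elements. *)
  have [v [v1 v2]] := sigma_unbounded (`|s1 g| + `|s2 g|).
  have := (ler_norm (- s1 g), ler_norm (- s2 g)); rewrite !normrN => -[g1 g2].
  have := (normr_ge0 (s1 g), normr_ge0 (s2 g)) => -[n1 n2].
  exists (g + v); first by apply: strict_cone_gt0; rewrite !sE; lra.
  by exists v; [apply: strict_cone_gt0; lra|rewrite addrK].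
- apply/seteqP; split=> [g [/strict_coneP[//|[g1 _]]]|_ ->].
    case=> h /strict_coneP[->|[h1 _]] gE; rewrite -gE !sE in g1 *; last by lra.
    by rewrite oppr0.
  by split; [left|exists 0; [left|rewrite oppr0]].
Qed.

(** Torsion-freeness settles the case where the multiple is 0; otherwise the sign of each coordinate
    is read off from its multiple. *)
Lemma unperforated_strict_cone : unperforated Gp.
Proof.
move=> g n n0 /strict_coneP[gn0|]; first by left; exact: Gtf _ _ n0 gn0.
rewrite !sE => -[]; rewrite !pmulrn_lgt0 // => *; exact: strict_cone_gt0.
Qed.

(** If one of [a], [b], [c], [b + c - a] vanishes, then 0, [a] or [b] is a witness. Otherwise all
    the inequalities are strict, and the witness is sought in the open rectangle that they cut
    out. *)
Lemma riesz_strict_cone : riesz_decomposition Gp.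
Proof.
have p0 : Gp 0 by left.
move=> a b c /[dup] pa /strict_coneP[->|[a1 a2]] pb pc.
  by exists 0; rewrite !subr0.
move: (pb) => /strict_coneP[b0|[b1 b2]].
  by rewrite b0 add0r; exists 0; rewrite !subr0.
move: (pc) => /strict_coneP[c0|[c1 c2]].
  by rewrite c0 addr0; exists a; rewrite !subrr.
move=> /strict_coneP[/subr0_eq <-|].
  by exists b; rewrite addrAC !subrr add0r subrr.
rewrite !sE => -[d1 d2].
have [||g []] := @sigma_box (Num.max 0 (s1 a - s1 c)) (Num.min (s1 b) (s1 a))
                            (Num.max 0 (s2 a - s2 c)) (Num.min (s2 b) (s2 a)).
- rewrite lt_min !gt_max b1 a1 /=.
  by apply/andP; split; lra.
- rewrite lt_min !gt_max b2 a2 /=.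
  by apply/andP; split; lra.
rewrite !lt_min !gt_max => /andP[? ?] /andP[? ?] /andP[? ?] /andP[? ?].
by exists g; split; apply: strict_cone_gt0; rewrite ?sE; lra.
Qed.

Lemma order_unit_strict_cone u : 0 < s1 u -> 0 < s2 u -> order_unit Gp u.
Proof.
move=> u1 u2; split; first exact: strict_cone_gt0.
move=> a.
exists (maxn (Num.trunc (s1 a / s1 u)).+1 (Num.trunc (s2 a / s2 u)).+1).
split; first by rewrite leq_max.
apply: strict_cone_gt0; rewrite !sE subr_gt0 -mulr_natl -ltr_pdivrMr //.
  by apply: lt_le_trans (truncnS_gt _) _; rewrite ler_nat leq_maxl.
by apply: lt_le_trans (truncnS_gt _) _; rewrite ler_nat leq_maxr.
Qed.

(** An element of [J] with two positive coordinates is an order unit, so convexity puts the whole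
    cone in [J]. Without such an element, [J] meets the cone only in 0 and vanishes, being generated
    by its positive elements. *)
Lemma simple_strict_cone J : order_ideal Gp J -> J = [set 0] \/ J = [set: G].
Proof.
move=> [[J0 JB] Jdir Jconv].
have JN a : J a -> J (- a) by move=> Ja; rewrite -sub0r; exact: JB.
have JD a b : J a -> J b -> J (a + b).
  by move=> Ja Jb; rewrite -[b]opprK; apply: JB => //; exact: JN.
have JMn a n : J a -> J (a *+ n).
  by move=> Ja; elim: n => [|n IH]; rewrite ?mulr0n // mulrS; exact: JD.
have [[b [Jb [b1 b2]]]|Nb] := pselect (exists b, J b /\ 0 < s1 b /\ 0 < s2 b).
  right; apply/seteqP; split=> // g _.
  have [p [q [pp pq ->]]] := coneB ordered_strict_cone g.
  have JP c : Gp c -> J c.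
    move=> pc; have [_ /(_ c)[k [_ pk]]] := order_unit_strict_cone b1 b2.
    exact: Jconv pk (JMn _ _ Jb).
  by apply: JB; exact: JP.
left; have JGp c : J c -> Gp c -> c = 0.
  by move=> Jc /strict_coneP[//|[c1 c2]]; case: Nb; exists c.
apply/seteqP; split=> [g /Jdir[a [Ja pa] [b [Jb pb] <-]]|_ -> //] /=.
by rewrite (JGp a) // (JGp b) // subrr.
Qed.

End StrictCone.

(** * States as barycenters of the two coordinates *)

(** The Archimedean property: an error bounded independently of [n] disappears on division by
    [n]. *)
Lemma ge0_of_mulrn_lb (R : realType) (x C : R) :
  (forall n : nat, - C <= x *+ n) -> 0 <= x.
Proof.
move=> lb; rewrite leNgt; apply/negP => x0.
have := lb (Num.trunc (C / - x)).+1; rewrite leNgt -mulr_natl => /negP; apply.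
rewrite ltrNr -mulrN -ltr_pdivrMr ?oppr_gt0 //; exact: truncnS_gt.
Qed.

Section States.
Context (R : realType) (G : zmodType) (sigma : {additive G -> (R * R)%type}).
Context (u1 u2 : G) (su1 : sigma u1 = (1, 0)) (su2 : sigma u2 = (0, 1)).

Let Gp := strict_cone sigma.
Let s1 g := (sigma g).1.
Let s2 g := (sigma g).2.

(* For [n >= 1], [n g] exceeds [a u1 + b u2] as soon as [a < n s1 g] and
   [b < n s2 g]; taking the largest such integers and letting [n] grow bounds
   [tau g] from below, and the same for [- g] from above. *)
Lemma state_barycenter (tau : G -> R) :
  zmod_morphism tau -> (forall g, Gp g -> 0 <= tau g) -> tau (u1 + u2) = 1 ->
  0 <= tau u1 <= 1 /\ forall g, tau g = tau u1 * s1 g + (1 - tau u1) * s2 g.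
Proof.
move=> tauB tau_ge0.
pose T : {additive G -> R} :=
  HB.pack tau (GRing.isZmodMorphism.Build G R tau tauB).
have TD a b : tau (a + b) = tau a + tau b := raddfD T a b.
have TN a : tau (- a) = - tau a := raddfN T a.
have TMn a n : tau (a *+ n) = tau a *+ n := raddfMn T n a.
have TMz a n : tau (a *~ n) = tau a *~ n := raddfMz T n a.
rewrite TD => tau1.
(* Since [u1] lies on the boundary and not in the cone, positivity is applied to
   [u1 *+ n + (u1 + u2)]; the error 1 is [tau (u1 + u2)]. *)
have t1 : 0 <= tau u1.
  apply: (@ge0_of_mulrn_lb _ _ 1) => n.
  have : 0 <= tau (u1 *+ n + (u1 + u2)).
    apply/tau_ge0/strict_cone_gt0; rewrite !raddfD !raddfMn /= su1 su2 /=.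
      by have := ler0n R n; lra.
    by rewrite mul0rn; lra.
  by rewrite !TD TMn; lra.
have t2 : 0 <= tau u2.
  apply: (@ge0_of_mulrn_lb _ _ 1) => n.
  have : 0 <= tau (u2 *+ n + (u1 + u2)).
    apply/tau_ge0/strict_cone_gt0; rewrite !raddfD !raddfMn /= su1 su2 /=.
      by rewrite mul0rn; lra.
    by have := ler0n R n; lra.
  by rewrite !TD TMn; lra.
(* One is subtracted from the floor to keep the upper inequality strict when [x] is an integer. *)
have below (x : R) : exists a : int, x - 2 <= a%:~R < x.
  exists (Num.floor x - 1); have := floor_itv x.
  by rewrite !intrD => /andP[? ?]; apply/andP; split; lra.
have lb g : 0 <= tau g - (tau u1 * s1 g + tau u2 * s2 g).
  (* Each coordinate is rounded down by at most 2, and the weights [tau u1] and [tau u2] sum to 1,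
     so the total error is at most 2. *)
  apply: (@ge0_of_mulrn_lb _ _ 2) => n.
  have [a /andP[a1 a2]] := below (s1 g *+ n).
  have [b /andP[b1 b2]] := below (s2 g *+ n).
  have : 0 <= tau (g *+ n - u1 *~ a - u2 *~ b).
    apply/tau_ge0/strict_cone_gt0.
      rewrite !raddfB !raddfMn !raddfMz su1 su2 /=.
      by rewrite oppr0 mul0rz -/(s1 g); lra.
    rewrite !raddfB !raddfMn !raddfMz su1 su2 /=.
      by rewrite oppr0 mul0rz -/(s2 g); lra.
  rewrite !TD !TN TMn !TMz -(mulrzr _ a) -(mulrzr _ b).
  rewrite -[tau g *+ n]mulr_natl -[X in _ -> _ <= X]mulr_natl.
  rewrite -mulr_natl -subr_ge0 in a1; rewrite -mulr_natl -subr_ge0 in b1.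
  have h1 := mulr_ge0 t1 a1; have h2 := mulr_ge0 t2 b1.
  lra.
have u2E : 1 - tau u1 = tau u2 by lra.
rewrite u2E; split; first by lra.
move=> g; apply/eqP; rewrite eq_le -[X in _ && X]subr_ge0 lb andbT.
have := lb (- g); rewrite TN /s1 /s2 raddfN /= -/(s1 g) -/(s2 g); lra.
Qed.

Lemma coordinate_states :
  states R Gp (u1 + u2) s1 /\ states R Gp (u1 + u2) s2.
Proof.
split; split.
- split=> [a b|_ [g /strict_coneP gp <-]]; first by rewrite /s1 raddfB.
  by case: gp => [->|[/ltW]//]; rewrite /s1 raddf0 /=.
- by rewrite /s1 raddfD su1 su2 /= addr0.
- split=> [a b|_ [g /strict_coneP gp <-]]; first by rewrite /s2 raddfB.
  by case: gp => [->|[_ /ltW]//]; rewrite /s2 raddf0 /=.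
- by rewrite /s2 raddfD su1 su2 /= add0r.
Qed.

Lemma statesP (tau : G -> R^o) : states R Gp (u1 + u2) tau ->
  exists t : R, 0 <= t <= 1 /\ forall g, tau g = t * s1 g + (1 - t) * s2 g.
Proof.
move=> [[tauB tau_ge0] tau1]; exists (tau u1).
by apply: state_barycenter => // g pg; apply: tau_ge0; exists g.
Qed.

(** The weight of a state is its value at [u1], so the states are parametrized by a segment. The
    coordinates are its endpoints, with values 1 and 0 at [u1]. *)
Lemma extremal_statesE : extremal_states R Gp (u1 + u2) = [set s1; s2].
Proof.
have [st1 st2] := coordinate_states.
have s1u1 : s1 u1 = 1 by rewrite /s1 su1.
have s2u1 : s2 u1 = 0 by rewrite /s2 su1.
(* This says that 1 and 0 are extreme points of the unit interval; it is applied to values at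
   [u1]. *)
have bary (t a b : R) : 0 < t < 1 -> 0 <= a <= 1 -> 0 <= b <= 1 ->
    (t * a + (1 - t) * b = 1 -> a = 1 /\ b = 1) /\
    (t * a + (1 - t) * b = 0 -> a = 0 /\ b = 0).
  by move=> *; split=> ?; split; nra.
apply/seteqP; split=> [tau [tauS ext]|_ [->|->]].
- have [t [/andP[t0 t1] tauE]] := statesP tauS.
  move: t0; rewrite le_eqVlt => /predU1P[t0|t0].
    by right; apply/funext => g; rewrite tauE -t0; lra.
  move: t1; rewrite le_eqVlt => /predU1P[t1|t1].
    by left; apply/funext => g; rewrite tauE t1; lra.
  (* For [0 < t < 1] the barycenter is a proper convex combination of [s1] and [s2], so extremality
     identifies [tau] with [s1]. *)
  left; have [] // := ext s1 s2 t st1 st2; first by rewrite t0.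
  exact/funext.
- split=> // y z t /statesP[a [a01 yE]] /statesP[b [b01 zE]] t01 e.
  have [+ _] := bary _ _ _ t01 a01 b01.
  have := congr1 (fun f : G -> R^o => f u1) e.
  rewrite /= -[RHS]/(t * y u1 + (1 - t) * z u1) yE zE s1u1 s2u1.
  rewrite !mulr0 !addr0 !mulr1.
  move=> /esym -> [] // a1 b1.
  by split; apply/funext => g; rewrite ?yE ?zE ?a1 ?b1; lra.
- split=> // y z t /statesP[a [a01 yE]] /statesP[b [b01 zE]] t01 e.
  have [_ +] := bary _ _ _ t01 a01 b01.
  have := congr1 (fun f : G -> R^o => f u1) e.
  rewrite /= -[RHS]/(t * y u1 + (1 - t) * z u1) yE zE s1u1 s2u1.
  rewrite !mulr0 !addr0 !mulr1.
  move=> /esym -> [] // a1 b1.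
  by split; apply/funext => g; rewrite ?yE ?zE ?a1 ?b1; lra.
Qed.

End States.

Theorem theorem1p1 (R : realType) (G : zmodType)
  (sigma : {additive G -> (R * R)%type})
  (Gcountable : countable [set: G]) (Gtf : torsion_free G)
  (sigmaZ2 : [set (a%:~R, b%:~R) | a in [set: int] & b in [set: int]]
               `<=` range sigma)
  (sigma_dense : dense (range sigma)) :
  let Gp := [set 0] `|` sigma @^-1` (`]0, +oo[ `*` `]0, +oo[) in
  let sigma1 := fun g => (sigma g).1 in
  let sigma2 := fun g => (sigma g).2 in
  simple_dimension_group Gp /\
  forall u1 u2 : G, sigma u1 = (1, 0) -> sigma u2 = (0, 1) ->
    let u := u1 + u2 in
    [/\ ~ Gp u1, ~ Gp u2, order_unit Gp u,
        states R Gp u sigma1 /\ states R Gp u sigma2 &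
        extremal_states R Gp u = [set sigma1; sigma2]].
Proof.
rewrite /= -/(strict_cone sigma); split.
  split; last by move=> J; exact: simple_strict_cone.
  apply: dimension_groupP; first exact: ordered_strict_cone.
    exact: unperforated_strict_cone.
  exact: riesz_strict_cone.
move=> u1 u2 su1 su2.
(* The images of [u1] and [u2] are nonzero points on the coordinate axes, which the strict cone
   excludes. *)
have not_gt0 g : sigma g != 0 -> (sigma g).1 = 0 \/ (sigma g).2 = 0 ->
    ~ strict_cone sigma g.
  move=> g0 gE /strict_coneP[gz|[g1 g2]]; first by rewrite gz raddf0 eqxx in g0.
  by case: gE => gE; rewrite gE ltxx in g1 g2.
split.
- apply: not_gt0; rewrite su1 /=; last by right.
  by rewrite xpair_eqE oner_eq0.
- apply: not_gt0; rewrite su2 /=; last by left.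
  by rewrite xpair_eqE oner_eq0 andbF.
- by apply: order_unit_strict_cone;
    rewrite raddfD su1 su2 /= ?addr0 ?add0r ltr01.
- exact: coordinate_states.
- exact: extremal_statesE.
Qed.
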